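(* Let $K$ be a field, $S=K[x_1,\dots,x_n]$, and let $I\subset S$ be a nonzero monomial ideal. Let $x_1,\dots,x_n,u_1t^{q_1},\dots,u_mt^{q_m}$ (with $u_i\in S$ monomials and $q_i>0$) be the minimal monomial generators of the symbolic Rees algebra $\mathcal{R}_s(I)=\bigoplus_{k\ge0}I^{(k)}t^k$ as a $K$-algebra. For all $k\ge1$ set $$d(I,k)=\max\Big\{\sum_{s=1}^m c_s\deg(u_s)\ :\ (c_1,\dots,c_m)\in\mathbb{Z}_{\ge0}^m,\ c_1q_1+\dots+c_mq_m\le k\Big\}.$$ Then for all $k\ge1$, $$\mathrm{reg}\,I^{(k)}\le \mathrm{reg}_x\,\mathcal{R}_s(I)+d(I,k).$$
   Context: $S=K[x_1,\dots,x_n]$ is standard graded and $\mathrm{reg}$ denotes Castelnuovo–Mumford regularity. For an ideal $I\subset S$ the $k$th symbolic power is $I^{(k)}=\bigcap_{P\in\mathrm{Ass}(I)}(I^kS_P\cap S)$, where $\mathrm{Ass}(I)$ is the set of associated primes of $S/I$. It is a known fact that for a monomial ideal $\mathcal{R}_s(I)\subset S[t]$ is a finitely generated $K$-algebra generated by monomials. The $x$-regularity: let $T=K[x_1,\dots,x_n,y_1,\dots,y_m]$ be bigraded by $\mathrm{bideg}(x_i)=(1,0)$ and $\mathrm{bideg}(y_j)=(\deg(u_j),q_j)$, and let $\varphi:T\to\mathcal{R}_s(I)$ be the $K$-algebra map with $\varphi(x_i)=x_i$, $\varphi(y_j)=u_jt^{q_j}$. Via $\varphi$, $\mathcal{R}_s(I)$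 is a finitely generated bigraded $T$-module. If $0\to F_p\to\cdots\to F_0\to\mathcal{R}_s(I)\to0$ is its minimal bigraded free $T$-resolution with $F_i=\bigoplus_jT(-a_{ij},-b_{ij})$, then $\mathrm{reg}_x\,\mathcal{R}_s(I)=\max_{i,j}\{a_{ij}-i\}$. *)

(* Defs.v *)
From HB Require Import structures.
From mathcomp Require Import all_boot all_order all_algebra.
From mathcomp Require Import boolp classical_sets mpoly.

Set Implicit Arguments.
Unset Strict Implicit.
Unset Printing Implicit Defensive.

Import Order.TTheory GRing.Theory Num.Theory.
Local Open Scope classical_set_scope.
Local Open Scope ring_scope.

(** * Ideals *)

Definition submodule (R : nzRingType) (L X : set R) : Prop :=
  [/\ X 0, (forall x y, X x -> X y -> X (x + y))
    & forall a x, L a -> X x -> X (a * x)].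

(* The L-submodule of R generated by G, for L a subring of R. *)
Definition submodule_gen (R : nzRingType) (L G : set R) : set R :=
  smallest (submodule L) G.

Definition ideal_gen (R : nzRingType) (G : set R) : set R :=
  submodule_gen setT G.

(* For k = 0 the only product is 1, so that I^0 is the unit ideal. *)
Definition ideal_pow (R : comNzRingType) (I : set R) (k : nat) : set R :=
  ideal_gen [set p | exists2 f : 'I_k -> R,
    (forall i, I (f i)) & p = \prod_(i < k) f i].

Definition monomial_ideal (K : fieldType) (n : nat) (I : set {mpoly K[n]}) :
    Prop :=
  exists G : set 'X_{1..n}, I = ideal_gen [set 'X_[K, a] | a in G].

(** * Symbolic powers *)

(* [prime_idealr_closed] alone does not say that P is a (proper) ideal. *)
Definition prime_ideal (R : comNzRingType) (P : set R) : Prop :=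
  idealr_closed (mem P) /\ prime_idealr_closed (mem P).

(* Associated primes of R / I: the primes of the form (I : f). *)
Definition Ass (R : comNzRingType) (I : set R) : set (set R) :=
  [set P | prime_ideal P /\ exists f : R, P = [set g | I (g * f)]].

(* R_P, as a subring of the fraction field of R. *)
Definition localization (R : idomainType) (P : set R) : set {fraction R} :=
  [set z | exists a s : R,
    ~ P s /\ z = @FracField.tofrac R a / @FracField.tofrac R s].

(* J R_P, contracted to R. *)
Definition local_contraction (R : idomainType) (P J : set R) : set R :=
  [set f | submodule_gen (localization P) (@FracField.tofrac R @` J)
             (@FracField.tofrac R f)].

(* If I = R, then Ass I is empty and the intersection is R. *)
Definition symb_pow (R : idomainType) (I : set R) (k : nat) : set R :=
  \bigcap_(P in Ass I) local_contraction P (ideal_pow I k).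

(** * The symbolic Rees algebra, inside S[t] = {poly {mpoly K[n]}} *)

Definition symb_rees (R : idomainType) (I : set R) : set {poly R} :=
  [set p | forall k, symb_pow I k p`_k].

Section Rees.
Variables (K : fieldType) (n m : nat).
Variables (u : 'I_m -> 'X_{1..n}) (q : 'I_m -> nat).

Definition scalarSt (c : K) : {poly {mpoly K[n]}} := (c%:MP)%:P.

Definition subalgebraSt (X : set {poly {mpoly K[n]}}) : Prop :=
  [/\ (forall c, X (scalarSt c)), (forall x y, X x -> X y -> X (x + y))
    & forall x y, X x -> X y -> X (x * y)].

(* x_1, ..., x_n, u_1 t^{q_1}, ..., u_m t^{q_m} *)
Definition rees_gen (i : 'I_(n + m)) : {poly {mpoly K[n]}} :=
  match split i with
  | inl i => ('X_i)%:P
  | inr j => ('X_[u j])%:P * 'X^(q j)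
  end.

(* The family rees_gen generates the K-algebra A, and none of its members
   can be omitted. *)
Definition minimal_rees_gen (A : set {poly {mpoly K[n]}}) : Prop :=
  smallest subalgebraSt (range rees_gen) = A /\
  forall i, smallest subalgebraSt (rees_gen @` [set j | j != i]) <> A.

(* The map phi : T -> S[t]; the y_j are the last m variables of T. *)
Definition rees_map (F : {mpoly K[n + m]}) : {poly {mpoly K[n]}} :=
  mmap scalarSt rees_gen F.

Definition bideg (i : 'I_(n + m)) : int * int :=
  match split i with
  | inl _ => (1, 0)
  | inr j => ((mdeg (u j))%:Z, (q j)%:Z)
  end.

Definition bihomog (d : int * int) : set {poly {mpoly K[n]}} :=
  [set p | forall k a, a \in msupp p`_k -> ((mdeg a)%:Z, k%:Z) = d].

(* Since q_s > 0, the constraint forces c_s <= k (see [max_gen_degP]). *)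
Definition max_gen_deg (k : nat) : nat :=
  (\max_(c : {ffun 'I_m -> 'I_k.+1} | \sum_(s < m) c s * q s <= k)
     \sum_(s < m) c s * mdeg (u s))%N.

Lemma max_gen_degP (k : nat) : (forall s, 0 < q s)%N ->
  (exists2 c : 'I_m -> nat, (\sum_(s < m) c s * q s <= k)%N &
     max_gen_deg k = (\sum_(s < m) c s * mdeg (u s))%N) /\
  (forall c : 'I_m -> nat, (\sum_(s < m) c s * q s <= k)%N ->
     (\sum_(s < m) c s * mdeg (u s) <= max_gen_deg k)%N).
Proof.
move=> q_gt0; split.
  rewrite /max_gen_deg.
  have P0 : (\sum_(s < m) [ffun=> ord0 : 'I_k.+1] s * q s <= k)%N.
    by rewrite big1 // => s _; rewrite ffunE mul0n.
  rewrite (bigop.bigmax_eq_arg [ffun=> ord0]) //.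
  by case: arg_maxnP => // c cP _; exists (fun s => c s : nat).
move=> c cP.
have ck s : (c s < k.+1)%N.
  rewrite ltnS; apply: leq_trans cP.
  by rewrite (bigD1 s) //= (leq_trans _ (leq_addr _ _)) // leq_pmulr.
pose f := [ffun s => Ordinal (ck s)].
have -> : (\sum_(s < m) c s * mdeg (u s) = \sum_(s < m) f s * mdeg (u s))%N.
  by apply: eq_bigr => s _; rewrite ffunE.
apply: (bigop.leq_bigmax_cond (F := fun g : {ffun 'I_m -> 'I_k.+1} =>
  (\sum_(s < m) g s * mdeg (u s))%N)).
by rewrite (eq_bigr (fun s => c s * q s)%N) // => s _; rewrite ffunE.
Qed.

End Rees.

(** * Minimal graded free resolutions and regularity *)

Section Resolution.
Variables (K : fieldType) (N : nat) (D : zmodType) (w : 'I_N -> D).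
Local Notation A := {mpoly K[N]}.

(* p is homogeneous of degree d for the grading of A giving 'X_i degree w i. *)
Definition wt_homog (d : D) : set A :=
  [set p | forall a, a \in msupp p -> \sum_(i < N) w i *+ a i = d].

(* The modules to be resolved are A-submodules M of a ring B on which A acts
   through act : A -> B; hom d is the set of homogeneous elements of degree d
   of B.  F_i = bigoplus_j A(- res_shift i j) is realised as the row vectors of
   size res_rank i, the differentials acting by multiplication on the right:
   res_diff i is F_{i+1} -> F_i, and res_aug lists the images
   in M of the basis of F_0. *)
Variables (B : nzRingType) (act : A -> B) (hom : D -> set B) (M : set B).

Definition aug_map r (e : 'I_r -> B) (v : 'rV[A]_r) : B :=
  \sum_(j < r) act (v 0 j) * e j.

Record min_graded_res := MinGradedRes {
  res_len : nat;
  res_rank : nat -> nat;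
  res_shift : forall i, 'I_(res_rank i) -> D;
  res_aug : 'I_(res_rank 0) -> B;
  res_diff : forall i, 'M[A]_(res_rank i.+1, res_rank i);
  res_rank_len : forall i, (res_len < i)%N -> res_rank i = 0%N;
  res_aug_homog : forall j, hom (res_shift j) (res_aug j);
  res_diff_homog : forall i j l,
    wt_homog (res_shift j - res_shift l) (res_diff i j l);
  res_aug_range : range (aug_map res_aug) = M;
  res_exact0 : forall v : 'rV_(res_rank 0),
    aug_map res_aug v = 0 <-> exists v', v = v' *m res_diff 0;
  res_exactS : forall i (v : 'rV_(res_rank i.+1)),
    v *m res_diff i = 0 <-> exists v', v = v' *m res_diff i.+1;
  (* the image of res_diff i lies in (X_1, ..., X_N) F_i *)
  res_minimal : forall i j l, (res_diff i j l)@_0%MM = 0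
}.

(* r is the maximum of deg (res_shift i j) - i over a minimal resolution of M. *)
Definition has_reg (deg : D -> int) (r : int) : Prop :=
  exists F : min_graded_res,
    (exists i (j : 'I_(res_rank F i)), r = deg (res_shift j) - i%:Z) /\
    (forall i (j : 'I_(res_rank F i)), deg (res_shift j) - i%:Z <= r).

End Resolution.

(* reg M = r, for M a graded ideal of the standard graded ring S *)
Definition is_reg (K : fieldType) (n : nat) (M : set {mpoly K[n]}) (r : int) :
    Prop :=
  has_reg (fun _ => 1 : int) id (@wt_homog K n int (fun _ => 1)) M id r.

(* reg_x A = r, for A a bigraded T-submodule of S[t] *)
Definition is_reg_x (K : fieldType) (n m : nat) (u : 'I_m -> 'X_{1..n})
    (q : 'I_m -> nat) (A : set {poly {mpoly K[n]}}) (r : int) : Prop :=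
  has_reg (bideg u q) (rees_map (K := K) u q) (@bihomog K n) A fst r.

(* Main.v *)
Require Import Defs.
From HB Require Import structures.
From mathcomp Require Import all_boot all_order all_algebra.
From mathcomp Require Import boolp classical_sets mpoly.

Set Implicit Arguments.
Unset Strict Implicit.
Unset Printing Implicit Defensive.

Import Order.TTheory GRing.Theory Num.Theory.
Local Open Scope classical_set_scope.
Local Open Scope ring_scope.

(** Let S = K[x_1, ..., x_n], let T = S[y_1, ..., y_m], and let G be a minimal
bigraded T-resolution of R_s(I) computing [rx].  Restrict scalars along S -> T.
Each T(-a, -b) is then a free S-module on the elements y^c e, so that G is also
an S-resolution of R_s(I), the direct sum of the I^(k) t^k.  Its part of
t-degree k resolves I^(k), and there the basis elements coming from T(-a, -b)
are the y^c e with b + sum_s c_s q_s = k, in x-degree a + sum_s c_s deg u_s.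
This resolution of I^(k) is not minimal, but every shift of the minimal
resolution F of I^(k) occurs in it in the same homological degree.  As b >= 0,
the constraint gives sum_s c_s q_s <= k, and the bound follows.

The part of G of degree k need not be isolated.  Two families of maps are
lifted through the resolutions: f : F -> G over I^(k) -> R_s(I), p |-> p t^k,
and g : G -> F over the S-linear projection R_s(I) -> I^(k), p |-> p`_k.  The
composite g f lifts the identity of I^(k), hence is homotopic to the identity,
hence is the identity modulo (x_1, ..., x_n) because F is minimal.  If f(e_j)
only involved monomials divisible by some x_i, then so would g(f(e_j)), and
its j-th coordinate would not have constant term 1 ([comparison_entry]).
So a coordinate of f(e_j) contains a pure monomial y^c; as f is bihomogeneous,
reading off its bidegree gives the shift of e_j ([shift_comparison]).

The lifts use three facts: T-modules of row vectors are projective over S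
([semilinear_lift]); a homogeneous vector in the image of a homogeneous map has
a homogeneous preimage ([homog_lift]); and the homotopy can be carried along
with f and g, one homological degree at a time ([comparison_step],
[comparison_next]).  The inequality b >= 0 comes from the minimality of G, in
which no basis element is sent to 0 ([res_shift_snd_ge0]). *)

(** * The extension S -> T and its semilinear maps *)

Section Extension.
Variables (K : fieldType) (n m : nat).
Local Notation S := {mpoly K[n]}.
Local Notation T := {mpoly K[n + m]}.

Definition xpart (a : 'X_{1..n + m}) : 'X_{1..n} :=
  [multinom a (lshift m i) | i < n].

(** The y-part stays among the monomials of T, so that [xmon (xpart a)] and
[ypart a] multiply back to [a]. *)
Definition ypart (a : 'X_{1..n + m}) : 'X_{1..n + m} :=
  [multinom (if split i is inl _ then 0%N else a i) | i < n + m].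

Definition xmon (b : 'X_{1..n}) : 'X_{1..n + m} :=
  [multinom (if split i is inl j then b j else 0%N) | i < n + m].

Lemma split_lshift (i : 'I_n) : split (lshift m i) = inl i.
Proof. exact: (@unsplitK n m (inl i)). Qed.

Lemma split_rshift (j : 'I_m) : split (rshift n j) = inr j.
Proof. exact: (@unsplitK n m (inr j)). Qed.

Lemma xpartK a : (xmon (xpart a) + ypart a)%MM = a.
Proof.
apply/mnmP => i; rewrite mnmDE !mnmE.
by case: (split_ordP i) => j ->; rewrite ?mnmE ?addn0.
Qed.

Lemma xpartD b a : xpart (xmon b + a)%MM = (b + xpart a)%MM.
Proof.
by apply/mnmP => i; rewrite mnmE !mnmDE !mnmE split_lshift.
Qed.

Lemma ypartD b a : ypart (xmon b + a)%MM = ypart a.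
Proof.
apply/mnmP => i; rewrite [LHS]mnmE [RHS]mnmE mnmDE [xmon _ _]mnmE.
by case: (split i).
Qed.

Definition inS : S -> T :=
  mmap (@mpolyC (n + m) K) (fun i => 'X_(lshift m i)).

HB.instance Definition _ := GRing.RMorphism.on inS.

Lemma inSC c : inS c%:MP = c%:MP.
Proof. exact: mmapC. Qed.

Lemma inSX b : inS 'X_[b] = 'X_[xmon b].
Proof.
rewrite /inS mmapX /mmap1 mpolyXE_id big_split_ord /= [X in _ * X]big1 ?mulr1.
  by apply: eq_bigr => i _; rewrite mnmE split_lshift.
by move=> i _; rewrite mnmE split_rshift.
Qed.

Lemma inSZX c b : inS (c *: 'X_[b]) = c *: 'X_[xmon b].
Proof. by rewrite -!mul_mpolyC rmorphM /= inSC inSX. Qed.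

Definition semilinear (V : lmodType S) r (g : 'rV[T]_r -> V) : Prop :=
  (forall v w, g (v + w) = g v + g w) /\
  (forall s v, g (inS s *: v) = s *: g v).

Section Semilinear.
Variables (V : lmodType S) (r : nat).

Lemma semilinear0 (g : 'rV[T]_r -> V) : semilinear g -> g 0 = 0.
Proof. by move=> [gD _]; apply: (addrI (g 0)); rewrite -gD !addr0. Qed.

Lemma semilinear_sum (g : 'rV[T]_r -> V) (J : Type) (s : seq J) (P : pred J) F :
  semilinear g -> g (\sum_(j <- s | P j) F j) = \sum_(j <- s | P j) g (F j).
Proof.
by move=> gL; apply: big_morph; [case: gL | apply: semilinear0].
Qed.

(** T is a free S-module on the monomials in the y variables. *)
Lemma semilinear_basis (g : 'rV[T]_r -> V) v : semilinear g ->
  g v = \sum_(l < r) \sum_(a <- msupp (v 0 l))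
    ((v 0 l)@_a *: 'X_[xpart a]) *: g ('X_[ypart a] *: delta_mx 0 l).
Proof.
move=> gL; rewrite {1}[v]row_sum_delta semilinear_sum //.
apply: eq_bigr => l _; rewrite {1}[v 0 l]mpolyE scaler_suml semilinear_sum //.
apply: eq_bigr => a _.
by rewrite -gL.2 inSZX scalerA -scalerAl -mpolyXD xpartK.
Qed.

(** The extension to T^r of values prescribed on its S-basis of the y^c e_l. *)
Definition semilinear_ext (E : 'X_{1..n + m} -> 'I_r -> V) (v : 'rV[T]_r) : V :=
  \sum_(l < r) \sum_(a <- msupp (v 0 l))
    ((v 0 l)@_a *: 'X_[xpart a]) *: E (ypart a) l.

(** Two polynomials have different supports; sums over a common larger list of
monomials can be added termwise. *)
Lemma msupp_sum_widen (E : 'X_{1..n + m} -> V) (p : T) s :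
  uniq s -> {subset msupp p <= s} ->
  \sum_(a <- msupp p) (p@_a *: 'X_[xpart a]) *: E a
  = \sum_(a <- s) (p@_a *: 'X_[xpart a]) *: E a.
Proof.
move=> s_uniq sub; rewrite [RHS](bigID (mem (msupp p))) /= [X in _ + X]big1.
  rewrite addr0 -[RHS]big_filter; apply: perm_big; apply: uniq_perm.
  - exact: msupp_uniq.
  - exact: filter_uniq.
  by move=> a; rewrite mem_filter; case: (boolP (a \in msupp p)) => // /sub ->.
by move=> a /memN_msupp_eq0 ->; rewrite !scale0r.
Qed.

Lemma semilinear_extP E : semilinear (semilinear_ext E).
Proof.
have extD v w :
    semilinear_ext E (v + w) = semilinear_ext E v + semilinear_ext E w.
  rewrite /semilinear_ext -big_split /=; apply: eq_bigr => l _.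
  rewrite mxE; move: (v 0 l) (w 0 l) => p p'.
  pose s := undup (msupp (p + p') ++ msupp p ++ msupp p').
  have sU : uniq s by apply: undup_uniq.
  have sub z : (z \in s) =
      [|| z \in msupp (p + p'), z \in msupp p | z \in msupp p'].
    by rewrite mem_undup !mem_cat.
  rewrite !(@msupp_sum_widen (fun a => E (ypart a) l) _ s) //.
  - rewrite -big_split /=; apply: eq_bigr => a _.
    by rewrite mcoeffD !scalerDl.
  - by move=> z zP; rewrite sub zP !orbT.
  - by move=> z zP; rewrite sub zP !orbT.
  by move=> z zP; rewrite sub zP.
have ext0 : semilinear_ext E 0 = 0.
  by rewrite /semilinear_ext big1 // => l _; rewrite mxE msupp0 big_nil.
have ext_sum J (s : seq J) F :
    semilinear_ext E (\sum_(j <- s) F j) = \sum_(j <- s) semilinear_ext E (F j).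
  by apply: big_morph.
have extX c b l : semilinear_ext E ((c *: 'X_[b]) *: delta_mx 0 l)
    = (c *: 'X_[xpart b]) *: E (ypart b) l.
  rewrite /semilinear_ext (bigD1 l) //= [X in _ + X]big1 ?addr0; last first.
    by move=> i il; rewrite !mxE eqxx (negbTE il) mulr0 msupp0 big_nil.
  rewrite !mxE !eqxx mulr1.
  have [->|c0] := eqVneq c 0; first by rewrite !scale0r msupp0 big_nil.
  by rewrite msuppMCX // big_seq1 mcoeffZ mcoeffX eqxx mulr1.
split=> // s v.
rewrite [v]row_sum_delta scaler_sumr !ext_sum scaler_sumr.
apply: eq_bigr => l _; move: (v 0 l) => p.
rewrite scalerA [p]mpolyE mulr_sumr !scaler_suml !ext_sum scaler_sumr.
apply: eq_bigr => a _; rewrite extX.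
rewrite [s]mpolyE rmorph_sum mulr_suml !scaler_suml ext_sum.
apply: eq_bigr => b _; rewrite /= inSZX.
rewrite -scalerAl -scalerAr -mpolyXD scalerA extX xpartD ypartD.
by rewrite scalerA -scalerAl -scalerAr -mpolyXD scalerA.
Qed.

Lemma semilinear_ext_basis E a l :
  semilinear_ext E ('X_[ypart a] *: delta_mx 0 l) = E (ypart a) l.
Proof.
have xy : xpart (ypart a) = 0%MM.
  by have := xpartD (xpart a) (ypart a); rewrite xpartK => /esym/eqP;
     rewrite -{2}[xpart a]addm0 (inj_eq (@addmI _ _)) => /eqP.
have yy : ypart (ypart a) = ypart a.
  by have := ypartD (xpart a) (ypart a); rewrite xpartK.
rewrite /semilinear_ext (bigD1 l) //= [X in _ + X]big1 ?addr0; last first.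
  by move=> i il; rewrite !mxE eqxx (negbTE il) mulr0 msupp0 big_nil.
rewrite !mxE !eqxx mulr1 msuppX big_seq1 mcoeffX eqxx yy xy.
by rewrite scale1r mpolyX0 scale1r.
Qed.

End Semilinear.

(** T^r is projective over S, because it is free: choose preimages of the images
of the basis elements. *)
Lemma semilinear_lift (V : lmodType S) r r' (p : {linear 'rV[S]_r' -> V})
    (h : 'rV[T]_r -> V) :
  semilinear h -> (forall v, exists w, p w = h v) ->
  exists g : 'rV[T]_r -> 'rV[S]_r', semilinear g /\ forall v, p (g v) = h v.
Proof.
move=> hL hp.
have [e eP] := choice hp.
pose E a l := e ('X_[a] *: delta_mx 0 l).
have EL := semilinear_extP E.
exists (semilinear_ext E); split=> // v.
rewrite (semilinear_basis _ EL) (semilinear_basis _ hL) linear_sum.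
apply: eq_bigr => l _; rewrite linear_sum; apply: eq_bigr => a _.
by rewrite linearZ semilinear_ext_basis /= /E eP.
Qed.

(** * Comparison of an S-resolution with a T-resolution *)

(** The data of the comparison in one homological degree, where dF and dG are the
differentials arriving in F_i and G_i: f and g map boundaries to boundaries,
and g f - 1 = N + h dF.  Here N stands for dF_(i-1) h_(i-1), the part of the
homotopy coming from degree i - 1; all that is kept of it is dF N = 0, and
that N vanishes modulo the variables.  The rows of f are the images of the
basis elements of F_i, and Q j prescribes their degrees. *)
Definition comparison rF rF' rG rG' (dF : 'M[S]_(rF', rF))
    (dG : 'M[T]_(rG', rG)) (Q : 'I_rF -> 'rV[T]_rG -> Prop) : Prop :=
  exists (f : 'M[T]_(rF, rG)) (g : 'rV[T]_rG -> 'rV[S]_rF)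
         (N : 'M[S]_rF) (h : 'M[S]_(rF, rF')),
  [/\ forall j, Q j (row j f), semilinear g,
      forall w : 'rV_rF', exists x, map_mx inS (w *m dF) *m f = x *m dG,
      forall v : 'rV_rG', exists w, g (v *m dG) = w *m dF &
      [/\ forall w, g (map_mx inS w *m f) = w + w *m N + w *m h *m dF,
          dF *m N = 0 & forall j l, (N j l)@_0%MM = 0]].

Lemma mulmx_inS_basis rF rG (f : 'M[T]_(rF, rG)) (w : 'rV[S]_rF) :
  map_mx inS w *m f = \sum_j inS (w 0 j) *: row j f.
Proof.
by rewrite mulmx_sum_row; apply: eq_bigr => j _; rewrite mxE.
Qed.

(** One step of the lifting, along arbitrary pF : F_i -> V and pG : G_i -> W.  For
i = 0 these are the augmentations; for i > 0, the differentials to F_(i-1) and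
G_(i-1).  The map [phi] is the composite of pF with the map V -> W to be
lifted, and [psi : W -> V] is the map lifted by g. *)
Lemma comparison_step rF rF' rG rG' (dF : 'M[S]_(rF', rF))
    (dG : 'M[T]_(rG', rG)) (Q : 'I_rF -> 'rV[T]_rG -> Prop)
    (W : zmodType) (act : T -> W -> W) (V : lmodType S)
    (pF : {linear 'rV[S]_rF -> V}) (pG : {additive 'rV[T]_rG -> W})
    (phi : 'rV[S]_rF -> W) (psi : W -> V) (N : 'M[S]_rF) :
    (forall a v, pG (a *: v) = act a (pG v)) ->
    (forall w, phi w = \sum_j act (inS (w 0 j)) (phi (delta_mx 0 j))) ->
    semilinear (fun v => psi (pG v)) ->
    (forall v, pF v = 0 <-> exists v', v = v' *m dF) ->
    (forall v, pG v = 0 <-> exists v', v = v' *m dG) ->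
    (forall j, exists2 x, Q j x & pG x = phi (delta_mx 0 j)) ->
    (forall w : 'rV_rF', phi (w *m dF) = 0) ->
    (forall v, exists w, pF w = psi (pG v)) ->
    (forall w, psi (phi w) = pF (w + w *m N)) ->
    dF *m N = 0 -> (forall j l, (N j l)@_0%MM = 0) ->
  comparison dF dG Q.
Proof.
move=> pGZ phiE psiL kerF kerG lift phi0 psi_im psi_phi dFN N0.
have /choice[e eQ] j : exists x, Q j x /\ pG x = phi (delta_mx 0 j).
  by have [x] := lift j; exists x.
pose f := \matrix_j e j.
have fE w : pG (map_mx inS w *m f) = phi w.
  rewrite mulmx_inS_basis raddf_sum phiE; apply: eq_bigr => j _.
  by rewrite pGZ rowK (eQ j).2.
have [g [gL gE]] := semilinear_lift psiL psi_im.
(* The rows of h: g f - 1 - N lands in the kernel of pF, on basis elements. *)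
have /choice[b bP] j : exists b : 'rV[S]_rF',
    g (row j f) = delta_mx 0 j + delta_mx 0 j *m N + b *m dF.
  have /kerF[b bE] :
      pF (g (row j f) - (delta_mx 0 j + delta_mx 0 j *m N)) = 0.
    by rewrite raddfB /= gE rowK (eQ j).2 psi_phi subrr.
  by exists b; rewrite -bE addrC subrK.
exists f, g, N, (\matrix_j b j); split=> //.
- by move=> j; rewrite rowK; case: (eQ j).
- by move=> w; apply/kerG; rewrite fE.
- move=> v; apply/kerF; rewrite gE.
  have -> : pG (v *m dG) = 0 by apply/kerG; exists v.
  by have /= := semilinear0 psiL; rewrite raddf0.
split=> // w.
rewrite mulmx_inS_basis semilinear_sum //.
have -> : w + w *m N = \sum_j w 0 j *: (delta_mx 0 j + delta_mx 0 j *m N).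
  rewrite {1 2}[w]row_sum_delta mulmx_suml -big_split /=.
  by apply: eq_bigr => j _; rewrite scalerDr -scalemxAl.
rewrite -mulmxA mulmx_sum_row -big_split /=.
by apply: eq_bigr => j _; rewrite gL.2 bP row_mul rowK !scalerDr.
Qed.

(** From one homological degree to the next: the new N is dF h, which is killed by
the next differential dF' and, by minimality of F, has no constant terms. *)
Lemma comparison_next rF rF' rF'' rG rG' rG'' (dF : 'M[S]_(rF', rF))
    (dF' : 'M[S]_(rF'', rF')) (dG : 'M[T]_(rG', rG)) (dG' : 'M[T]_(rG'', rG'))
    (Q : 'I_rF -> 'rV[T]_rG -> Prop) (Q' : 'I_rF' -> 'rV[T]_rG' -> Prop) :
    (forall v : 'rV_rF', v *m dF = 0 <-> exists v', v = v' *m dF') ->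
    (forall v : 'rV_rG', v *m dG = 0 <-> exists v', v = v' *m dG') ->
    (forall j l, (dF j l)@_0%MM = 0) ->
    (forall (f : 'M_(rF, rG)) j (x : 'rV_rG'), (forall j, Q j (row j f)) ->
       x *m dG = map_mx inS (row j dF) *m f ->
       exists2 x', Q' j x' & x' *m dG = map_mx inS (row j dF) *m f) ->
  comparison dF dG Q -> comparison dF' dG' Q'.
Proof.
move=> exF exG dF0 lift [f [g [N [h [fQ gL fd gd [gfE dFN N0]]]]]].
have dF'dF : dF' *m dF = 0.
  by apply/row_matrixP => j; rewrite row_mul row0; apply/exF;
     exists (delta_mx 0 j); rewrite rowE.
apply: (@comparison_step rF' rF'' rG' rG'' dF' dG' Q' 'rV[T]_rG
  (fun a v => a *: v) 'rV[S]_rF (@mulmxr _ 1 _ _ dF) (@mulmxr _ 1 _ _ dG)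
  (fun w : 'rV_rF' => map_mx inS (w *m dF) *m f) g (dF *m h)) => //=.
- by move=> a v; rewrite scalemxAl.
- move=> w; rewrite map_mxM -mulmxA mulmx_inS_basis; apply: eq_bigr => j _.
  by rewrite -rowE row_mul map_row.
- split=> [v w|s v]; first by rewrite mulmxDl gL.1.
  by rewrite -scalemxAl gL.2.
- move=> j; rewrite -rowE; have [x xE] := fd (delta_mx 0 j).
  by apply: (lift f j x) => //; rewrite -xE rowE.
- by move=> w; rewrite -mulmxA dF'dF mulmx0 map_mx0 mul0mx.
- by move=> v; have [w wE] := gd v; exists w.
- move=> w; rewrite gfE -[w *m dF *m N]mulmxA dFN mulmx0 addr0 !mulmxDl.
  by rewrite mulmxA.
- by rewrite mulmxA dF'dF mul0mx.
move=> j l; rewrite mxE raddf_sum big1 // => i _.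
by rewrite /= rmorphM /= dF0 mul0r.
Qed.

(** Modulo the variables of S, g f is the identity.  Since g is S-linear, f(e_j)
cannot lie in (x_1, ..., x_n) G_i. *)
Lemma comparison_entry rF rF' rG rG' (dF : 'M[S]_(rF', rF))
    (dG : 'M[T]_(rG', rG)) (Q : 'I_rF -> 'rV[T]_rG -> Prop) j :
  (forall j l, (dF j l)@_0%MM = 0) -> comparison dF dG Q ->
  exists x, Q j x /\ exists l a, a \in msupp (x 0 l) /\ xpart a = 0%MM.
Proof.
move=> dF0 [f [g [N [h [fQ gL _ _ [gfE _ N0]]]]]].
exists (row j f); split=> //.
apply: contrapT => noa.
suff : (g (row j f) 0 j)@_0%MM = 0.
  have -> : row j f = map_mx inS (delta_mx 0 j) *m f.
    by rewrite map_delta_mx rowE.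
  rewrite gfE -rowE !mxE !eqxx !mcoeffD mcoeff1 eqxx /= N0 addr0 raddf_sum big1.
    by move/eqP; rewrite addr0 oner_eq0.
  by move=> i _; rewrite /= rmorphM /= dF0 mulr0.
rewrite (semilinear_basis _ gL) summxE raddf_sum big1 // => l _.
rewrite summxE raddf_sum big_seq big1 // => a aP.
rewrite mxE /= rmorphM /= mcoeffZ mcoeffX; case: eqP => [a0|_]; last first.
  by rewrite mulr0 mul0r.
by case: noa; exists l, a.
Qed.

End Extension.

(** * Homogeneous components and homogeneous preimages *)

Section Grading.
Variables (K : fieldType) (N : nat) (D : zmodType) (w : 'I_N -> D).
Local Notation A := {mpoly K[N]}.

Definition weight (a : 'X_{1..N}) : D := \sum_(i < N) w i *+ a i.

Lemma weightD a b : weight (a + b)%MM = weight a + weight b.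
Proof.
by rewrite -big_split; apply: eq_bigr => i _; rewrite mnmDE mulrnDr.
Qed.

Definition hcomp (d : D) (p : A) : A :=
  \sum_(a <- msupp p | weight a == d) p@_a *: 'X_[a].

Lemma hcomp_homog d p : wt_homog w d (hcomp d p).
Proof.
move=> a /msupp_sum_le/flattenP[s /mapP[b]]; rewrite mem_filter.
move=> /andP[/eqP bd _] -> /msuppZ_le.
by rewrite msuppX inE => /eqP ->.
Qed.

Lemma wt_homogM d e (p p' : A) :
  wt_homog w d p -> wt_homog w e p' -> wt_homog w (d + e) (p * p').
Proof.
move=> pd pe a /msuppM_le/allpairsP[[b c] /= [bp cp ->]].
by rewrite -/(weight _) weightD; congr (_ + _); [apply: pd | apply: pe].
Qed.

Lemma wt_homog_sum (J : finType) d (F : J -> A) :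
  (forall j, wt_homog w d (F j)) -> wt_homog w d (\sum_j F j).
Proof.
move=> Fd a /msupp_sum_le/flattenP[s /mapP[j _ ->]]; exact: Fd.
Qed.

(** The component of degree d of a preimage is again a preimage.  The grading of
the target is given by coordinates [chi c], each supported in one degree
[deg c]; for polynomials these are the coefficients. *)
Lemma homog_lift r (sh : 'I_r -> D) (B : zmodType) (C : Type)
    (p : {additive 'rV[A]_r -> B}) (chi : C -> B -> K) (deg : C -> D) :
    (forall c x y, chi c (x + y) = chi c x + chi c y) ->
    (forall x y, (forall c, chi c x = chi c y) -> x = y) ->
    (forall b a l c, chi c (p ((b *: 'X_[a]) *: delta_mx 0 l)) != 0 ->
       weight a + sh l = deg c) ->
  forall d v, (forall c, chi c (p v) != 0 -> deg c = d) ->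
  exists2 v' : 'rV[A]_r, forall l, wt_homog w (d - sh l) (v' 0 l) & p v' = p v.
Proof.
move=> chiD chi_sep homp d v pv.
have chi0 c : chi c 0 = 0 by apply: (addrI (chi c 0)); rewrite -chiD !addr0.
have chi_sum c := big_morph (chi c) (chiD c) (chi0 c).
exists (\row_l hcomp (d - sh l) (v 0 l)).
  by move=> l; rewrite mxE; apply: hcomp_homog.
have expand (u : 'rV[A]_r) (P : 'I_r -> pred 'X_{1..N}) c :
    (forall l, u 0 l = \sum_(a <- msupp (v 0 l) | P l a) (v 0 l)@_a *: 'X_[a]) ->
    chi c (p u) = \sum_l \sum_(a <- msupp (v 0 l) | P l a)
      chi c (p (((v 0 l)@_a *: 'X_[a]) *: delta_mx 0 l)).
  move=> uE; rewrite {1}[u]row_sum_delta raddf_sum chi_sum.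
  by apply: eq_bigr => l _; rewrite uE scaler_suml raddf_sum chi_sum.
apply: chi_sep => c.
rewrite (expand _ (fun l a => weight a == d - sh l)); last first.
  by move=> l; rewrite mxE.
have [cd|cd] := eqVneq (deg c) d; last first.
  (* Off degree d both coordinates vanish. *)
  have [-> |/pv/eqP] := eqVneq (chi c (p v)) 0; last by rewrite (negbTE cd).
  apply: big1 => l _; apply: big1 => a /eqP aE.
  apply: contraNeq cd => /homp <-.
  by rewrite aE subrK.
(* In degree d, the monomials of v dropped from v' do not contribute. *)
rewrite [RHS](expand _ (fun _ => predT)); last by move=> l; rewrite -mpolyE.
apply: eq_bigr => l _; rewrite big_mkcond; apply: eq_bigr => a _ /=.
case: ifPn => // aE; apply/esym; apply: contraNeq aE => /homp.
by rewrite cd => <-; rewrite addrK.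
Qed.

End Grading.

Lemma weight_mdeg n (b : 'X_{1..n}) : weight (fun=> 1 : int) b = (mdeg b)%:Z.
Proof.
rewrite mdegE (big_morph Posz PoszD (erefl _)).
by apply: eq_bigr => i _; rewrite natz.
Qed.

Lemma homog_lift_mx (K : fieldType) (N : nat) (D : zmodType) (w : 'I_N -> D)
    r r' (sh : 'I_r -> D) (sh' : 'I_r' -> D) (A : 'M[{mpoly K[N]}]_(r, r')) :
    (forall j l, wt_homog w (sh j - sh' l) (A j l)) ->
  forall d (v : 'rV_r), (forall l, wt_homog w (d - sh' l) ((v *m A) 0 l)) ->
  exists2 v' : 'rV_r,
    forall j, wt_homog w (d - sh j) (v' 0 j) & v' *m A = v *m A.
Proof.
move=> Ah d v vAh.
apply: (@homog_lift K N D w r sh _ _ (@mulmxr _ 1 _ _ A)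
  (fun c (y : 'rV_r') => (y 0 c.1)@_c.2) (fun c => weight w c.2 + sh' c.1)).
- by move=> c x y; rewrite mxE mcoeffD.
- by move=> x y xy; apply/rowP => l; apply/mpolyP => a; apply: (xy (l, a)).
- move=> b a j [l c] /=.
  rewrite -scalemxAl -rowE !mxE -scalerAl mcoeffZ mulf_eq0 negb_or.
  move=> /andP[_]; rewrite -mcoeff_msupp.
  move=> /msuppM_le/allpairsP[[x y] /= [xP yP ->]].
  move: xP; rewrite msuppX inE => /eqP ->.
  rewrite weightD -addrA; congr (_ + _).
  by rewrite [weight w y](Ah _ _ _ yP) subrK.
move=> [l c] /=; rewrite -mcoeff_msupp => /vAh.
by rewrite -/(weight w c) => ->; rewrite subrK.
Qed.

(** * The bigraded T-module S[t] *)

Section AugMap.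
Variables (K : fieldType) (N : nat) (B : nzRingType).
Variables (act : {rmorphism {mpoly K[N]} -> B}) (r : nat) (e : 'I_r -> B).

Lemma aug_map_additive : additive (aug_map act e).
Proof.
move=> v w; rewrite /aug_map -sumrB; apply: eq_bigr => j _.
by rewrite !mxE rmorphB mulrBl.
Qed.

HB.instance Definition _ :=
  GRing.isAdditive.Build 'rV_r B (aug_map act e) aug_map_additive.

Lemma aug_mapZ a v : aug_map act e (a *: v) = act a * aug_map act e v.
Proof.
rewrite /aug_map mulr_sumr; apply: eq_bigr => j _.
by rewrite mxE rmorphM /= mulrA.
Qed.

End AugMap.

Section ReesAlgebra.
Variables (K : fieldType) (n m : nat) (u : 'I_m -> 'X_{1..n}) (q : 'I_m -> nat).
Local Notation S := {mpoly K[n]}.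
Local Notation T := {mpoly K[n + m]}.
Local Notation rmap := (rees_map (K := K) u q).

HB.instance Definition _ :=
  GRing.RMorphism.copy (@scalarSt K n) (polyC \o @mpolyC n K).
HB.instance Definition _ :=
  GRing.RMorphism.copy rmap (mmap (@scalarSt K n) (rees_gen K u q)).

(** The map phi sends the monomial b of T to
[xpart b + ymon b] in S times t^[ydeg b] ([rees_mapX]). *)
Definition ymon (b : 'X_{1..n + m}) : 'X_{1..n} :=
  (\sum_(s < m) u s *+ b (rshift n s))%MM.

Definition ydeg (b : 'X_{1..n + m}) : nat :=
  (\sum_(s < m) b (rshift n s) * q s)%N.

Lemma rees_mapX b :
  rmap 'X_[b] = ('X_[(xpart b + ymon b)%MM])%:P * 'X^(ydeg b).
Proof.
rewrite /rees_map mmapX /mmap1 big_split_ord /= mpolyXD polyCM -mulrA.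
congr (_ * _).
  rewrite mpolyXE_id rmorph_prod; apply: eq_bigr => i _.
  by rewrite /rees_gen split_lshift mnmE rmorphXn.
rewrite /ymon /ydeg -mprodXnE rmorph_prod -prodrXr -big_split /=.
apply: eq_bigr => j _.
by rewrite /rees_gen split_rshift exprMn -exprM mulnC rmorphXn.
Qed.

Lemma weight_bideg b : weight (bideg u q) b =
  ((mdeg (xpart b + ymon b)%MM)%:Z, (ydeg b)%:Z).
Proof.
have pairMn (z : int * int) k : z *+ k = (z.1 *+ k, z.2 *+ k).
  by elim: k => // k IH; rewrite !mulrS IH.
have fstE := big_morph (@fst int int) (id2 := 0) (op2 := +%R)
  (fun _ _ => erefl) erefl.
have sndE := big_morph (@snd int int) (id2 := 0) (op2 := +%R)
  (fun _ _ => erefl) erefl.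
rewrite /weight [LHS]surjective_pairing fstE sndE !big_split_ord /=.
congr (_, _).
  rewrite mdegD mdegE PoszD /ymon mdeg_sum !(big_morph Posz PoszD (erefl _)).
  congr (_ + _); apply: eq_bigr => i _.
    by rewrite /bideg split_lshift pairMn mnmE -[1]/(1%:Z) natz.
  by rewrite /bideg split_rshift pairMn mdegMn /= PoszM -mulr_natr natz.
rewrite [X in X + _]big1 ?add0r /ydeg.
  rewrite (big_morph Posz PoszD (erefl _)); apply: eq_bigr => i _.
  by rewrite /bideg split_rshift pairMn /= PoszM -mulr_natr natz mulrC.
by move=> i _; rewrite /bideg split_lshift pairMn /= mul0rn.
Qed.

Lemma xpart_xmon (b : 'X_{1..n}) : xpart (xmon m b) = b.
Proof. by apply/mnmP => i; rewrite !mnmE split_lshift. Qed.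

Lemma ymon_xmon b : ymon (xmon m b) = 0%MM.
Proof.
apply/mnmP => i; rewrite /ymon mnm_sumE big1 ?mnmE // => s _.
by rewrite mulmnE mnmE split_rshift muln0.
Qed.

Lemma ydeg_xmon b : ydeg (xmon m b) = 0%N.
Proof. by rewrite /ydeg big1 // => s _; rewrite mnmE split_rshift. Qed.

Lemma rees_map_inS (s : S) : rmap (inS m s) = s%:P.
Proof.
rewrite [s]mpolyE (rmorph_sum (inS m)) rmorph_sum (rmorph_sum (@polyC _)).
apply: eq_bigr => b _ /=.
rewrite inSZX -!mul_mpolyC !rmorphM /= rees_mapX.
rewrite xpart_xmon ymon_xmon ydeg_xmon addm0 expr0 mulr1.
by congr (_ * _); rewrite /rees_map mmapC.
Qed.

Lemma inS_homog d (s : S) : wt_homog (fun=> 1 : int) d s ->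
  wt_homog (bideg u q) (d, 0) (inS m s).
Proof.
move=> sd a; rewrite [s]mpolyE rmorph_sum /=.
move=> /msupp_sum_le/flattenP[t /mapP[b]]; rewrite filter_predT => bs ->.
rewrite inSZX => /msuppZ_le; rewrite msuppX inE => /eqP ->.
rewrite -/(weight _ _) weight_bideg xpart_xmon ymon_xmon ydeg_xmon addm0.
by congr (_, _); rewrite -(sd _ bs) -weight_mdeg.
Qed.

Lemma homog_lift_rees r (sh : 'I_r -> int * int) (e : 'I_r -> {poly S}) :
    (forall j, bihomog (sh j) (e j)) ->
  forall d v, bihomog d (aug_map rmap e v) ->
  exists2 v' : 'rV[T]_r, forall l, wt_homog (bideg u q) (d - sh l) (v' 0 l) &
    aug_map rmap e v' = aug_map rmap e v.
Proof.
move=> eh d v vh.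
apply: (@homog_lift K _ _ _ r sh _ _ (aug_map rmap e)
  (fun c (y : {poly S}) => (y`_c.1)@_c.2) (fun c => ((mdeg c.2)%:Z, c.1%:Z))).
- by move=> c x y; rewrite coefD mcoeffD.
- by move=> x y xy; apply/polyP => k; apply/mpolyP => a; apply: (xy (k, a)).
- move=> b a j [k c] /=.
  rewrite /aug_map (bigD1 j) //= big1 ?addr0; last first.
    by move=> i ij; rewrite !mxE eqxx (negbTE ij) mulr0 rmorph0 mul0r.
  rewrite !mxE !eqxx mulr1 -mul_mpolyC rmorphM /= rees_mapX {1}/rees_map mmapC.
  rewrite /scalarSt -!mulrA coefCM coefCM coefXnM mcoeffCM mulf_eq0 negb_or.
  move=> /andP[_]; case: ltnP => [_|ek]; first by rewrite mulr0 mcoeff0 eqxx.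
  rewrite -mcoeff_msupp.
  move=> /msuppM_le/allpairsP[[x y] /= [xP yP ->]].
  move: xP; rewrite msuppX inE => /eqP ->.
  rewrite -(eh _ _ _ yP) weight_bideg [mdeg (_ + y)%MM]mdegD PoszD.
  by congr (_, _); rewrite -[in RHS](subnK ek) PoszD addrC.
by move=> [k c] /=; rewrite -mcoeff_msupp => /vh.
Qed.

End ReesAlgebra.

(** * Minimality *)

Section MinimalResolution.
Variables (K : fieldType) (N : nat) (D : zmodType) (w : 'I_N -> D).
Variables (B : nzRingType) (act : {mpoly K[N]} -> B) (hom : D -> set B).
Variables (M : set B) (F : min_graded_res w act hom M).

Lemma res_augP p : M p <-> exists v, aug_map act (res_aug (m:=F)) v = p.
Proof.
have rangeP : range (aug_map act (res_aug (m:=F))) p = M p.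
  by rewrite res_aug_range.
split; first by rewrite -[M p]rangeP => -[v _ <-]; exists v.
by move=> [v vp]; rewrite -rangeP; exists v.
Qed.

(** The image of a differential consists of vectors without constant terms; so a
basis element is not a cycle, and its image is nonzero. *)
Lemma basis_notin_image i (j : 'I_(res_rank F i)) :
  ~ exists v' : 'rV_(res_rank F i.+1), delta_mx 0 j = v' *m res_diff F i.
Proof.
move=> [v' /(congr1 (fun y : 'rV__ => (y 0 j)@_0%MM))].
rewrite !mxE !eqxx mcoeff1 eqxx raddf_sum big1 => [/eqP|l _].
  by rewrite oner_eq0.
by rewrite /= rmorphM /= res_minimal mulr0.
Qed.

Lemma res_aug_neq0 (j : 'I_(res_rank F 0)) :
  act 0 = 0 -> act 1 = 1 -> res_aug j <> 0.
Proof.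
move=> act0 act1 j0; apply: (@basis_notin_image 0 j); apply/res_exact0.
rewrite /aug_map (bigD1 j) //= big1 ?addr0 => [|l lj].
  by rewrite mxE !eqxx act1 mul1r.
by rewrite mxE eqxx (negbTE lj) act0 mul0r.
Qed.

Lemma res_diff_row_neq0 i (j : 'I_(res_rank F i.+1)) :
  exists l, res_diff F i j l != 0.
Proof.
apply: contrapT => no; apply: (@basis_notin_image i.+1 j); apply/res_exactS.
rewrite -rowE; apply/rowP => l; rewrite !mxE.
by apply/eqP; apply: contrapT => jl; apply: no; exists l; apply/negP.
Qed.

End MinimalResolution.

Lemma mpoly_neq0_msupp (K : fieldType) (N : nat) (p : {mpoly K[N]}) :
  p != 0 -> exists a, a \in msupp p.
Proof.
rewrite -msupp_eq0; case: (msupp p) => // a s _.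
by exists a; rewrite mem_head.
Qed.

(** * The shifts of the minimal resolution of a graded piece *)

(** The ideal I^(k) is replaced by any J, and R_s(I) by any A, such that
J t^k is contained in A and the coefficient of t^k maps A to J. *)
Section Comparison.
Variables (K : fieldType) (n m : nat) (u : 'I_m -> 'X_{1..n}) (q : 'I_m -> nat).
Variables (k : nat) (J : set {mpoly K[n]}) (A : set {poly {mpoly K[n]}}).
Local Notation S := {mpoly K[n]}.
Local Notation T := {mpoly K[n + m]}.
Variable F : min_graded_res (fun=> 1 : int) id
  (@wt_homog K n int (fun=> 1)) J.
Variable G : min_graded_res (bideg u q) (rees_map (K := K) u q)
  (@bihomog K n) A.

(** A nonzero homogeneous element has degree >= 0 in t.  By induction on i: since
the image of the l-th basis element is nonzero, its t-degree is that of a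
basis element of G_(i-1) plus that of a monomial of T. *)
Lemma res_shift_snd_ge0 i (l : 'I_(res_rank G i)) : 0 <= (res_shift l).2.
Proof.
elim: i l => [|i IH] l.
  have /eqP := @res_aug_neq0 _ _ _ _ _ _ _ _ G l (rmorph0 _) (rmorph1 _).
  rewrite -lead_coef_eq0 => /mpoly_neq0_msupp[a].
  by rewrite lead_coefE => /(res_aug_homog (m:=G) l) <-.
have [l' /mpoly_neq0_msupp[a /(@res_diff_homog _ _ _ _ _ _ _ _ G i l l')]] :=
  res_diff_row_neq0 l.
rewrite -/(weight _ _) weight_bideg => /(congr1 snd) /= E.
rewrite -(subrK (res_shift l').2 (res_shift l).2) -E.
by rewrite addr_ge0.
Qed.

(** The vector x of G_i has the bidegree (res_shift j, k) of e_j t^k. *)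
Definition row_degree i (j : 'I_(res_rank F i)) (x : 'rV[T]_(res_rank G i)) :=
  forall l, wt_homog (bideg u q) ((res_shift j, k%:Z) - res_shift l) (x 0 l).

Hypothesis JA : forall p, J p -> A (p%:P * 'X^k).
Hypothesis AJ : forall p, A p -> J p`_k.

Lemma comparison_res i :
  comparison (res_diff F i) (res_diff G i) (@row_degree i).
Proof.
elim: i => [|i IH].
  (* The augmentation of F as a matrix, so that it is a linear map. *)
  pose E : 'cV[S]_(res_rank F 0) := \col_j res_aug (m:=F) j.
  have augE (v : 'rV_(res_rank F 0)) :
      aug_map id (res_aug (m:=F)) v = (v *m E) 0 0.
    by rewrite mxE; apply: eq_bigr => j _; rewrite mxE.
  have JE (v : 'rV_(res_rank F 0)) : J ((v *m E) 0 0).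
    by rewrite -augE; apply/(res_augP F); exists v.
  apply: (@comparison_step _ _ _ _ _ _ _ (res_diff F 0) (res_diff G 0)
    (@row_degree 0) {poly S} (fun a p => rees_map u q a * p) 'M[S]_1
    (@mulmxr _ 1 _ _ E) (aug_map (rees_map u q) (res_aug (m:=G)))
    (fun w => ((w *m E) 0 0)%:P * 'X^k) (fun p => (p`_k)%:M) 0) => /=.
  - by move=> a v; rewrite aug_mapZ.
  - move=> w; rewrite mulmx_sum_row summxE rmorph_sum mulr_suml.
    apply: eq_bigr => j _.
    by rewrite rees_map_inS mulrA -rowE mxE rmorphM.
  - split=> [v w|s v]; first by rewrite raddfD coefD raddfD.
    by rewrite aug_mapZ /= rees_map_inS coefCM scale_scalar_mx.
  - move=> v; apply: iff_trans (res_exact0 v); rewrite augE.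
    split=> [->|v0]; first by rewrite mxE.
    by apply/matrixP => a b; rewrite !ord1 v0 mxE.
  - by move=> v; apply: res_exact0.
  - move=> j; rewrite -rowE.
    have : A (((row j E) 0 0)%:P * 'X^k) by apply: JA; rewrite rowE; apply: JE.
    move=> /(res_augP G)[v vE].
    have [||v' v'h v'E] := @homog_lift_rees K n m u q _
      (@res_shift _ _ _ _ _ _ _ _ G 0) (res_aug (m:=G)) _
      (res_shift j, k%:Z) v.
    + by move=> l; apply: res_aug_homog.
    + rewrite vE => l a; rewrite coefCM coefXn.
      case: eqP => [->|_]; last by rewrite mulr0 msupp0.
      rewrite mulr1 !mxE => /(res_aug_homog (m:=F) j) <-.
      by rewrite -weight_mdeg.
    by exists v'; [exact: v'h | rewrite v'E].
  - move=> w; have -> : (w *m res_diff F 0 *m E) 0 0 = 0.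
      by rewrite -augE; apply/res_exact0; exists w.
    by rewrite mul0r.
  - move=> v.
    have : J (aug_map (rees_map u q) (res_aug (m:=G)) v)`_k.
      by apply: AJ; apply/(res_augP G); exists v.
    move=> /(res_augP F)[w wE]; exists w.
    by rewrite -wE augE [LHS]mx11_scalar.
  - move=> w; rewrite mulmx0 addr0 coefCM coefXn eqxx mulr1.
    by rewrite [RHS]mx11_scalar.
  - by rewrite mulmx0.
  by move=> j l; rewrite mxE mcoeff0.
apply: comparison_next IH.
- by move=> v; apply: res_exactS.
- by move=> v; apply: res_exactS.
- exact: res_minimal.
move=> f j x fh xE; rewrite -xE.
apply: homog_lift_mx => [l l'|l]; first exact: res_diff_homog.
rewrite xE mxE; apply: wt_homog_sum => b.
rewrite !mxE.
have -> : (res_shift j, k%:Z) - res_shift l =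
    (res_shift j - res_shift b, 0) + ((res_shift b, k%:Z) - res_shift l).
  rewrite addrA; congr (_ - _).
  by congr (_, _); rewrite /= ?subrK ?add0r.
apply: wt_homogM; first by apply: inS_homog; apply: res_diff_homog.
by have := fh b l; rewrite mxE.
Qed.

(** A monomial y^c without x in a coordinate l of f(e_j) gives the equality of
bidegrees (res_shift j, k) = (a + sum_s c_s deg u_s, b + sum_s c_s q_s), where
(a, b) = res_shift l. *)
Lemma shift_comparison i (j : 'I_(res_rank F i)) :
  exists (l : 'I_(res_rank G i)) (c : 'I_m -> nat),
    (\sum_(s < m) c s * q s <= k)%N /\
    res_shift j = (res_shift l).1 + (\sum_(s < m) c s * mdeg (u s))%N%:Z.
Proof.
have [x [xh [l [a [ax a0]]]]] :=
  comparison_entry j (@res_minimal _ _ _ _ _ _ _ _ F i) (comparison_res i).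
exists l, (fun s => a (rshift n s)).
have := xh l a ax; rewrite -/(weight _ _) weight_bideg a0 add0m => E.
split.
  rewrite -lez_nat -/(ydeg q a).
  have := congr1 snd E; rewrite /= => ->.
  by rewrite gerBl res_shift_snd_ge0.
have := congr1 fst E; rewrite /= /ymon mdeg_sum => E1.
rewrite addrC -[LHS](subrK (res_shift l).1) -E1.
by congr (_%:Z + _); apply: eq_bigr => s _; rewrite mdegMn mulnC.
Qed.

End Comparison.

Lemma symb_pow0 (R : idomainType) (I : set R) k : symb_pow I k 0.
Proof.
by move=> P _ X [[X0 _ _] _]; rewrite rmorph0.
Qed.

Theorem theorem1p1 (K : fieldType) (n : nat) (I : set {mpoly K[n]})
    (m : nat) (u : 'I_m -> 'X_{1..n}) (q : 'I_m -> nat)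
    (I_monomial : monomial_ideal I) (I_neq0 : I <> [set 0])
    (q_gt0 : forall j, (0 < q j)%N)
    (gen_rees : minimal_rees_gen u q (symb_rees I))
    (rx : int) (reg_rees : is_reg_x u q (symb_rees I) rx) :
  forall k : nat, (1 <= k)%N ->
  forall r : int, is_reg (symb_pow I k) r ->
    r <= rx + (max_gen_deg u q k)%:Z.
Proof.
move=> k _ r [F [[i [j ->]] _]].
have [G [_ Grx]] := reg_rees.
have [||l [c [ck ->]]] := @shift_comparison K n m u q k _ _ F G _ _ i j.
- move=> p Ip k'; rewrite coefCM coefXn; case: eqP => [->|_].
    by rewrite mulr1.
  by rewrite mulr0; apply: symb_pow0.
- by move=> p; apply.
rewrite addrAC lerD ?Grx // lez_nat.
exact: (max_gen_degP u k q_gt0).2.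
Qed.
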